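(* Let $\mathscr{C},\mathscr{D}$ be categories with a dual adjunction $(F,G,\eta)$ as in the context, where $\mathscr{C}$ has binary coproducts and $\mathscr{D}$ has binary products. For $i=1,2$ let $L_i:\mathscr{C}\to\mathscr{C}$ and $T_i:\mathscr{D}\to\mathscr{D}$ be functors and $\delta^i:L_iG\Rightarrow GT_i$ natural transformations. Let $A$ be an object of $\mathscr{C}$ and $\alpha:L_1A+L_2A\to A$ a morphism. Suppose that for $i=1,2$ the adjoint transpose $\hat\delta^i_A:T_iFA\to FL_iA$ has a right inverse $\zeta^i_A:FL_iA\to T_iFA$, i.e. $\hat\delta^i_A\circ\zeta^i_A=\mathrm{id}_{FL_iA}$. Define $\beta:L_1GFA+L_2GFA\to GFA$ by $$\beta=GF\alpha\circ G\langle F\iota_1,F\iota_2\rangle\circ G(\zeta^1_A\times\zeta^2_A)\circ[G\pi_1,G\pi_2]\circ(\delta^1_{FA}+\delta^2_{FA}).$$ Then $\beta\circ(L_1\eta_A+L_2\eta_A)=\eta_A\circ\alpha$; that is, $\eta_A$ is an $(L_1+L_2)$-algebra morphism from $(A,\alpha)$ to $(GFA,\beta)$.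
   Context: A dual adjunction consists of contravariant functors $F:\mathscr{C}\to\mathscr{D}$ and $G:\mathscr{D}\to\mathscr{C}$ together with bijections $\mathscr{C}(A,GX)\cong\mathscr{D}(X,FA)$, natural in $A$ and $X$. This is equivalent to $F\dashv G$ with $F:\mathscr{C}\to\mathscr{D}^{\mathrm{op}}$. For $f:A\to GX$ write $f^\flat:X\to FA$ for the corresponding morphism. The unit $\eta_A:A\to GFA$ corresponds to $\mathrm{id}_{FA}$. Naturality of $\delta^i$ means $GT_ih\circ\delta^i_Y=\delta^i_X\circ L_iGh$ for every $h:X\to Y$ in $\mathscr{D}$. The adjoint transpose is $\hat\delta^i_A:=(\delta^i_{FA}\circ L_i\eta_A)^\flat:T_iFA\to FL_iA$. In the definition of $\beta$: - $\iota_j:L_jA\to L_1A+L_2A$ are the coproduct injections, so $F\iota_j:F(L_1A+L_2A)\to FL_jA$. - $\langle F\iota_1,F\iota_2\rangle:F(L_1A+L_2A)\to FL_1A\times FL_2A$ is the induced map into the product. - $\pi_j:T_1FA\times T_2FA\to T_jFA$ are the projections. - $[G\pi_1,G\pi_2]:GT_1FA+GT_2FA\to G(T_1FA\times T_2FA)$ is the copairing. *)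

(* Defs.v *)
From mathcomp Require Import ssreflect ssrfun.

Set Implicit Arguments.
Unset Strict Implicit.
Unset Printing Implicit Defensive.

Declare Scope cat_scope.
Delimit Scope cat_scope with cat.

Record category := Category {
  ob :> Type;
  hom : ob -> ob -> Type;
  idm : forall a, hom a a;
  comp : forall a b c, hom b c -> hom a b -> hom a c;
  comp_idl : forall a b (f : hom a b), comp (idm b) f = f;
  comp_idr : forall a b (f : hom a b), comp f (idm a) = f;
  compA : forall a b c d (h : hom c d) (g : hom b c) (f : hom a b),
    comp h (comp g f) = comp (comp h g) f
}.
Arguments hom {_} _ _.
Arguments idm {_} a.
Arguments comp {_ a b c} g f.

Notation "g \o f" := (comp g f) : cat_scope.
Local Open Scope cat_scope.

Record functor (C D : category) := Functor {
  fob :> C -> D;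
  fmap : forall a b : C, hom a b -> hom (fob a) (fob b);
  fmap_id : forall a : C, fmap (idm a) = idm (fob a);
  fmap_comp : forall (a b c : C) (g : hom b c) (f : hom a b),
    fmap (g \o f) = fmap g \o fmap f
}.
Arguments fmap {C D} _ {a b} f.

(* Contravariant functors, without passing through an opposite category. *)
Record cofunctor (C D : category) := Cofunctor {
  cob :> C -> D;
  cmap : forall a b : C, hom a b -> hom (cob b) (cob a);
  cmap_id : forall a : C, cmap (idm a) = idm (cob a);
  cmap_comp : forall (a b c : C) (g : hom b c) (f : hom a b),
    cmap (g \o f) = cmap f \o cmap g
}.
Arguments cmap {C D} _ {a b} f.

(* The composites L G and G T of a contravariant G with an endofunctor on either
   side. *)
Section Composites.
Variables C D : category.

Program Definition post_comp (L : functor C C) (G : cofunctor D C) :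
    cofunctor D C :=
  @Cofunctor D C (fun X => L (G X)) (fun X Y h => fmap L (cmap G h)) _ _.
Next Obligation. by move=> L G X /=; rewrite cmap_id fmap_id. Qed.
Next Obligation. by move=> L G X Y Z k h /=; rewrite cmap_comp fmap_comp. Qed.

Program Definition pre_comp (G : cofunctor D C) (T : functor D D) :
    cofunctor D C :=
  @Cofunctor D C (fun X => G (T X)) (fun X Y h => cmap G (fmap T h)) _ _.
Next Obligation. by move=> G T X /=; rewrite fmap_id cmap_id. Qed.
Next Obligation. by move=> G T X Y Z k h /=; rewrite fmap_comp cmap_comp. Qed.

End Composites.

Record conat_trans (D C : category) (H K : cofunctor D C) := ConatTrans {
  component :> forall X : D, hom (H X) (K X);
  naturality : forall (X Y : D) (h : hom X Y),
    cmap K h \o component Y = component X \o cmap H h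
}.

(* [flat] is the bijection C(A, G X) ~ D(X, F A), with inverse [sharp]. *)
Record dual_adjunction (C D : category)
    (F : cofunctor C D) (G : cofunctor D C) := DualAdjunction {
  flat : forall (A : C) (X : D), hom A (G X) -> hom X (F A);
  sharp : forall (A : C) (X : D), hom X (F A) -> hom A (G X);
  flatK : forall (A : C) (X : D), cancel (@flat A X) (@sharp A X);
  sharpK : forall (A : C) (X : D), cancel (@sharp A X) (@flat A X);
  flat_naturalA : forall (A A' : C) (X : D) (a : hom A' A) (f : hom A (G X)),
    flat (f \o a) = cmap F a \o flat f;
  flat_naturalX : forall (A : C) (X X' : D) (x : hom X' X) (f : hom A (G X)),
    flat (cmap G x \o f) = flat f \o x
}.
Arguments flat {C D F G} _ {A X} f.
Arguments sharp {C D F G} _ {A X} g.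

Definition adj_unit (C D : category) (F : cofunctor C D) (G : cofunctor D C)
    (adj : dual_adjunction F G) (A : C) : hom A (G (F A)) :=
  sharp adj (idm (F A)).

Record binary_coproducts (C : category) := BinaryCoproducts {
  sum_ob : C -> C -> C;
  inj1 : forall a b : C, hom a (sum_ob a b);
  inj2 : forall a b : C, hom b (sum_ob a b);
  copair : forall a b c : C, hom a c -> hom b c -> hom (sum_ob a b) c;
  copair_inj1 : forall (a b c : C) (f : hom a c) (g : hom b c),
    copair f g \o inj1 a b = f;
  copair_inj2 : forall (a b c : C) (f : hom a c) (g : hom b c),
    copair f g \o inj2 a b = g;
  copair_unique : forall (a b c : C) (f : hom a c) (g : hom b c)
      (u : hom (sum_ob a b) c),
    u \o inj1 a b = f -> u \o inj2 a b = g -> u = copair f g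
}.
Arguments inj1 {C} _ a b.
Arguments inj2 {C} _ a b.
Arguments copair {C} _ {a b c} f g.

Record binary_products (D : category) := BinaryProducts {
  prod_ob : D -> D -> D;
  proj1 : forall a b : D, hom (prod_ob a b) a;
  proj2 : forall a b : D, hom (prod_ob a b) b;
  pairing : forall a b c : D, hom c a -> hom c b -> hom c (prod_ob a b);
  proj1_pairing : forall (a b c : D) (f : hom c a) (g : hom c b),
    proj1 a b \o pairing f g = f;
  proj2_pairing : forall (a b c : D) (f : hom c a) (g : hom c b),
    proj2 a b \o pairing f g = g;
  pairing_unique : forall (a b c : D) (f : hom c a) (g : hom c b)
      (u : hom c (prod_ob a b)),
    proj1 a b \o u = f -> proj2 a b \o u = g -> u = pairing f g
}.
Arguments proj1 {D} _ a b.
Arguments proj2 {D} _ a b.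
Arguments pairing {D} _ {a b c} f g.

Definition sum_map (C : category) (S : binary_coproducts C) (a b a' b' : C)
    (f : hom a a') (g : hom b b') : hom (sum_ob S a b) (sum_ob S a' b') :=
  copair S (inj1 S a' b' \o f) (inj2 S a' b' \o g).

Definition prod_map (D : category) (P : binary_products D) (a b a' b' : D)
    (f : hom a a') (g : hom b b') : hom (prod_ob P a b) (prod_ob P a' b') :=
  pairing P (f \o proj1 P a b) (g \o proj2 P a b).

Lemma sum_map_id (C : category) (S : binary_coproducts C) (a b : C) :
  sum_map S (idm a) (idm b) = idm (sum_ob S a b).
Proof.
by symmetry; apply: copair_unique; rewrite comp_idl comp_idr.
Qed.

Lemma sum_map_comp (C : category) (S : binary_coproducts C)
    (a b a' b' a'' b'' : C) (f' : hom a' a'') (g' : hom b' b'')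
    (f : hom a a') (g : hom b b') :
  sum_map S (f' \o f) (g' \o g) = sum_map S f' g' \o sum_map S f g.
Proof.
symmetry; apply: copair_unique.
- by rewrite -compA copair_inj1 compA copair_inj1 -compA.
- by rewrite -compA copair_inj2 compA copair_inj2 -compA.
Qed.

Program Definition sum_functor (C : category) (S : binary_coproducts C)
    (L1 L2 : functor C C) : functor C C :=
  @Functor C C (fun A => sum_ob S (L1 A) (L2 A))
    (fun A B f => sum_map S (fmap L1 f) (fmap L2 f)) _ _.
Next Obligation. by move=> C S L1 L2 A /=; rewrite !fmap_id sum_map_id. Qed.
Next Obligation.
by move=> C S L1 L2 A B E g f /=; rewrite !fmap_comp sum_map_comp.
Qed.

Definition algebra_morphism (C : category) (L : functor C C) (A B : C)
    (alpha : hom (L A) A) (beta : hom (L B) B) (f : hom A B) : Prop :=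
  f \o alpha = beta \o fmap L f.

Definition adjoint_transpose (C D : category)
    (F : cofunctor C D) (G : cofunctor D C) (adj : dual_adjunction F G)
    (L : functor C C) (T : functor D D)
    (delta : conat_trans (post_comp L G) (pre_comp G T)) (A : C) :
    hom (T (F A)) (F (L A)) :=
  flat adj (delta (F A) \o fmap L (adj_unit adj A)).

Section Beta.
Variables (C D : category) (F : cofunctor C D) (G : cofunctor D C).
Variables (S : binary_coproducts C) (P : binary_products D).
Variables (L1 L2 : functor C C) (T1 T2 : functor D D).
Variable delta1 : conat_trans (post_comp L1 G) (pre_comp G T1).
Variable delta2 : conat_trans (post_comp L2 G) (pre_comp G T2).
Variables (A : C) (alpha : hom (sum_ob S (L1 A) (L2 A)) A).
Variable zeta1 : hom (F (L1 A)) (T1 (F A)).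
Variable zeta2 : hom (F (L2 A)) (T2 (F A)).

Definition beta :
    hom (sum_ob S (L1 (G (F A))) (L2 (G (F A)))) (G (F A)) :=
  cmap G (cmap F alpha)
  \o cmap G (pairing P (cmap F (inj1 S (L1 A) (L2 A)))
                       (cmap F (inj2 S (L1 A) (L2 A))))
  \o cmap G (prod_map P zeta1 zeta2)
  \o copair S (cmap G (proj1 P (T1 (F A)) (T2 (F A))))
              (cmap G (proj2 P (T1 (F A)) (T2 (F A))))
  \o sum_map S (delta1 (F A)) (delta2 (F A)).

End Beta.

(* Main.v *)
(* Precomposed with the unit, each [delta^i] composed with [G zeta^i] becomes the
   unit at [L_i A]: its transpose is [hat delta^i o zeta^i = id].  Testing
   against the coproduct injections, the part of [beta] following [G F alpha]
   thus becomes the unit at [L_1 A + L_2 A], and naturality of the unit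
   concludes. *)
From mathcomp Require Import ssreflect ssrfun.
Require Import Defs.

Local Open Scope cat_scope.

Lemma coproduct_hom_ext (C : category) (S : binary_coproducts C) (a b c : C)
    (u v : hom (sum_ob S a b) c) :
  u \o inj1 S a b = v \o inj1 S a b -> u \o inj2 S a b = v \o inj2 S a b ->
  u = v.
Proof.
by move=> e1 e2; rewrite (copair_unique e1 e2); symmetry; apply: copair_unique.
Qed.

Lemma pairing_comp (D : category) (P : binary_products D) (a b c d : D)
    (f : hom c a) (g : hom c b) (h : hom d c) :
  pairing P f g \o h = pairing P (f \o h) (g \o h).
Proof.
by apply: pairing_unique; rewrite compA (proj1_pairing, proj2_pairing).
Qed.

Section Unit.
Context (C D : category) (F : cofunctor C D) (G : cofunctor D C).
Context (adj : dual_adjunction F G).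

Lemma flat_unit (A : C) : flat adj (adj_unit adj A) = idm (F A).
Proof. exact: sharpK. Qed.

(** Both sides have transpose [cmap F f], and [flat] is injective. *)
Lemma unit_natural (A B : C) (f : hom A B) :
  adj_unit adj B \o f = cmap G (cmap F f) \o adj_unit adj A.
Proof.
apply: (can_inj (@flatK _ _ _ _ adj _ _)).
by rewrite flat_naturalA flat_naturalX !flat_unit comp_idl comp_idr.
Qed.

(** By naturality in [X], the transpose of [cmap G z \o d] is [flat adj d \o z], and the unit is the
    only morphism with transpose the identity. *)
Lemma unit_of_right_inverse (B : C) (X : D) (d : hom B (G X))
    (z : hom (F B) X) :
  flat adj d \o z = idm (F B) -> cmap G z \o d = adj_unit adj B.
Proof.
move=> dz; apply: (can_inj (@flatK _ _ _ _ adj _ _)).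
by rewrite flat_naturalX dz flat_unit.
Qed.

Lemma unit_of_right_inverses (S : binary_coproducts C) (P : binary_products D)
    (B1 B2 : C) (X1 X2 : D) (d1 : hom B1 (G X1)) (d2 : hom B2 (G X2))
    (z1 : hom (F B1) X1) (z2 : hom (F B2) X2) :
  flat adj d1 \o z1 = idm (F B1) -> flat adj d2 \o z2 = idm (F B2) ->
  cmap G (pairing P (cmap F (inj1 S B1 B2)) (cmap F (inj2 S B1 B2)))
  \o cmap G (prod_map P z1 z2)
  \o copair S (cmap G (proj1 P X1 X2)) (cmap G (proj2 P X1 X2))
  \o sum_map S d1 d2 = adj_unit adj (sum_ob S B1 B2).
Proof.
move=> /unit_of_right_inverse dz1 /unit_of_right_inverse dz2.
(* The two images under [G] merge into that of the single pairing with components $z_j \circ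
   F\iota_j$. *)
rewrite -cmap_comp /prod_map pairing_comp -!compA proj1_pairing proj2_pairing.
apply: coproduct_hom_ext; rewrite unit_natural -!compA.
- rewrite copair_inj1 [copair _ _ _ \o _]compA copair_inj1.
  (* Contravariance selects the first component: $G(z_1 \circ F\iota_1) = GF\iota_1 \circ Gz_1$. *)
  by rewrite compA -cmap_comp proj1_pairing cmap_comp -compA dz1.
- rewrite copair_inj2 [copair _ _ _ \o _]compA copair_inj2.
  by rewrite compA -cmap_comp proj2_pairing cmap_comp -compA dz2.
Qed.

End Unit.
Arguments unit_of_right_inverses {C D F G adj} S P {B1 B2 X1 X2 d1 d2 z1 z2} _ _.

Theorem theorem6 (C D : category) (F : cofunctor C D) (G : cofunctor D C)
    (adj : dual_adjunction F G)
    (S : binary_coproducts C) (P : binary_products D)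
    (L1 L2 : functor C C) (T1 T2 : functor D D)
    (delta1 : conat_trans (post_comp L1 G) (pre_comp G T1))
    (delta2 : conat_trans (post_comp L2 G) (pre_comp G T2))
    (A : C) (alpha : hom (sum_ob S (L1 A) (L2 A)) A)
    (zeta1 : hom (F (L1 A)) (T1 (F A)))
    (zeta2 : hom (F (L2 A)) (T2 (F A)))
    (hzeta1 : adjoint_transpose adj delta1 A \o zeta1 = idm (F (L1 A)))
    (hzeta2 : adjoint_transpose adj delta2 A \o zeta2 = idm (F (L2 A))) :
  let eta := adj_unit adj in
  let b := beta P delta1 delta2 alpha zeta1 zeta2 in
  b \o sum_map S (fmap L1 (eta A)) (fmap L2 (eta A)) = eta A \o alpha
  /\ algebra_morphism (L := sum_functor S L1 L2) alpha b (eta A).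
Proof.
move=> eta b.
suff eta_alg : b \o sum_map S (fmap L1 (eta A)) (fmap L2 (eta A)) = eta A \o alpha.
  by split=> //; rewrite /algebra_morphism -eta_alg.
(* The unit at $L_1A+L_2A$ is expanded with $d_i = \delta^i_{FA} \circ L_i\eta_A$, whose transpose
   is $\hat\delta^i_A$ by definition. *)
rewrite unit_natural -(unit_of_right_inverses S P hzeta1 hzeta2).
by rewrite sum_map_comp /b /beta -!compA.
Qed.
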